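(* For every integer $n\ge 2$, the set $\mathcal{I}_n\setminus\overline{\mathcal{E}}_n$ is infinite; that is, there are infinitely many irreducible polynomials of degree $n$ with integer coefficients that are not shifted Eisenstein polynomials.
   Context: $\mathcal{I}_n$ denotes the set of polynomials in $\mathbb{Z}[x]$ of degree $n$ that are irreducible, i.e. not a product of two polynomials of positive degree in $\mathbb{Z}[x]$ (equivalently, irreducible in $\mathbb{Q}[x]$). A polynomial $f(x)=a_nx^n+\cdots+a_1x+a_0\in\mathbb{Z}[x]$ of degree $n$ is called Eisenstein if there is a prime $p$ such that (i) $p\mid a_i$ for $i=0,\ldots,n-1$, (ii) $p^2\nmid a_0$, (iii) $p\nmid a_n$. It is called a shifted Eisenstein polynomial if there exists an integer $s$ such that $f(x+s)$ is Eisenstein. $\overline{\mathcal{E}}_n$ denotes the set of shifted Eisenstein polynomials of degree $n$ in $\mathbb{Z}[x]$. *)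

(* Defs.v *)
From HB Require Import structures.
From mathcomp Require Import all_boot all_order all_algebra.
From mathcomp Require Import boolp classical_sets cardinality.

Set Implicit Arguments.
Unset Strict Implicit.
Unset Printing Implicit Defensive.

Import Order.TTheory GRing.Theory Num.Theory.
Local Open Scope classical_set_scope.
Local Open Scope ring_scope.

(* [size f = n.+1] says that f has degree n. The factors g and h range over
   Z[x], and constant factors are ignored, so f need not be primitive.
   polydiv's [irreducible_poly] is instead phrased with pseudo-divisibility,
   which over int is divisibility in Q[x]. *)
Definition irreducible_polys (n : nat) : set {poly int} :=
  [set f : {poly int} | size f = n.+1 /\
     ~ (exists g h : {poly int},
          [/\ (1 < size g)%N, (1 < size h)%N & f = g * h])].

Definition eisenstein (n : nat) (f : {poly int}) : Prop :=
  size f = n.+1 /\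
  exists p : nat,
    [/\ prime p,
        forall i : nat, (i < n)%N -> (p%:Z %| f`_i)%Z,
        ~~ (p%:Z ^+ 2 %| f`_0)%Z
      & ~~ (p%:Z %| f`_n)%Z].

(* [f \Po ('X + s%:P)] is f(x + s). *)
Definition shifted_eisensteins (n : nat) : set {poly int} :=
  [set f : {poly int} | size f = n.+1 /\ exists s : int, eisenstein n (f \Po ('X + s%:P))].

(* Main.v *)
Require Import Defs.
From mathcomp Require Import all_boot all_order all_algebra.
From mathcomp Require Import boolp classical_sets cardinality.
From mathcomp Require Import ring zify.

(** The witnesses are the odd multiples [c f] of [f = 2x^n + 2x + 1]. The
    reversal of [f] is Eisenstein at 2, so [c f] is irreducible. If
    [c f(x + s)] is Eisenstein at [p], then [p] does not divide the leading
    coefficient [2c], and [f] is congruent mod [p] to [2 (x - s)^n]. So [s] is a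
    root mod [p] of [f], of [f'] and, when [n > 2], of [f'']; elementary algebra
    in the prime field shows that this is impossible when [p] is odd. *)

Import GRing.Theory.
Local Open Scope ring_scope.

(** Modulo [p], [f] is a nonzero constant, hence so are the reductions of [g] and [h]. Both factors
    have positive degree, so both lose their leading coefficients, and [p] ^ 2 divides the product
    of these. *)
Lemma reverse_eisenstein_irreducible (p : nat) (f : {poly int}) :
    prime p -> ~~ (p%:Z %| f`_0)%Z ->
    (forall i, (0 < i)%N -> (p%:Z %| f`_i)%Z) ->
    ~~ (p%:Z ^+ 2 %| lead_coef f)%Z ->
  ~ (exists g h : {poly int},
       [/\ (1 < size g)%N, (1 < size h)%N & f = (g * h)]).
Proof.
move=> p_pr pNf0 pf pNlead [g [h [sg sh fE]]].
pose red := map_poly (intr : int -> 'F_p).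
have pz z : (p%:Z %| z)%Z = (z%:~R == 0 :> 'F_p).
  by rewrite (dvdz_pcharf (pchar_Fp p_pr)).
have redf : red f = ((f`_0)%:~R%:P).
  apply/polyP => -[|i]; rewrite coef_map coefC //=.
  by apply/eqP; rewrite -pz pf.
have sred : size (red g * red h) = 1%N.
  have <- : red f = red g * red h by rewrite /red fE rmorphM.
  by rewrite redf size_polyC -pz pNf0.
have [redg0 redh0] : red g != 0 /\ red h != 0.
  by apply/andP; rewrite -negb_or -mulf_eq0 -size_poly_eq0 sred.
have plead q r : red q != 0 -> red r != 0 -> size (red q * red r) = 1%N ->
    (1 < size q)%N -> (p%:Z %| lead_coef q)%Z.
  move=> q0 r0 + sq; rewrite size_mul // => sqr.
  have arith (a b c : nat) : (a + b).-1 = 1 -> (0 < b)%N -> (1 < c)%N ->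
    (a <= c.-1)%N by lia.
  have sq1 : (size (red q) <= (size q).-1)%N.
    by apply: arith sqr _ sq; rewrite size_poly_gt0.
  by rewrite pz lead_coefE -(coef_map intr) /= nth_default.
case/negP: pNlead; rewrite fE lead_coefM expr2 dvdz_mul //.
- exact: plead redg0 redh0 sred sg.
- by apply: plead redh0 redg0 _ sh; rewrite mulrC.
Qed.

(** The ring is a parameter so that the reduction mod [p] is again a [trinomial]. *)
Definition trinomial (R : nzRingType) (n : nat) : {poly R} :=
  2%:P * 'X^n + 2%:P * 'X + 1.

Lemma coef_trinomial (R : nzRingType) (n i : nat) :
  (trinomial R n)`_i = 2 * (i == n)%:R + 2 * (i == 1)%:R + (i == 0)%:R.
Proof. by rewrite !coefD !coefCM coefXn coefX coef1. Qed.

Lemma size_trinomial (n : nat) : (1 < n)%N -> size (trinomial int n) = n.+1.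
Proof.
move=> n_gt1; apply/anti_leq/andP; split.
  apply/leq_sizeP => i ltni; rewrite coef_trinomial.
  by rewrite !gtn_eqF ?mulr0 ?addr0 //; lia.
rewrite ltnNge; apply/negP => /leq_sizeP/(_ n (leqnn n)).
rewrite coef_trinomial eqxx.
by have [-> ->] : (n == 1)%N = false /\ (n == 0)%N = false by lia.
Qed.

Lemma map_trinomial (p n : nat) :
  map_poly (intr : int -> 'F_p) (trinomial int n) = trinomial 'F_p n.
Proof.
apply/polyP => i; rewrite coef_map !coef_trinomial /=.
by rewrite !rmorphD !rmorphM /= !rmorph_nat.
Qed.

Lemma deriv_comp_shift (R : comNzRingType) (q : {poly R}) (s : R) :
  (q \Po ('X + s%:P))^`() = q^`() \Po ('X + s%:P).
Proof. by rewrite deriv_comp derivD derivX derivC addr0 mulr1. Qed.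

Lemma deriv_trinomial (R : comNzRingType) (n : nat) :
  (trinomial R n)^`() = (2 * n%:R)%:P * 'X^(n.-1) + 2%:P.
Proof.
rewrite /trinomial !derivD !derivM !derivC derivXn derivX !mul0r mulr1 !add0r.
by rewrite addr0 -(mulr_natl 'X^(n.-1)) mulrA polyCM !polyC_natr.
Qed.

Lemma trinomial_neq_shift_power (F : fieldType) (n : nat) (a s : F) :
    (1 < n)%N -> 2 != 0 :> F ->
  trinomial F n \Po ('X + s%:P) <> a *: 'X^n.
Proof.
move=> n_gt1 two0 E.
have dE : (trinomial F n)^`() \Po ('X + s%:P) = (a *: 'X^n)^`().
  by rewrite -E deriv_comp_shift.
have ddE : (trinomial F n)^`()^`() \Po ('X + s%:P) = (a *: 'X^n)^`()^`().
  by rewrite -dE deriv_comp_shift.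
have n0 : (n == 0)%N = false by case: n n_gt1 {E dE ddE}.
have n10 : (n.-1 == 0)%N = false by case: n n_gt1 {E dE ddE n0} => [|[]].
(* Evaluating a shifted polynomial at 0 evaluates the original at [s]. *)
have E0 : 2 * s ^+ n + 2 * s + 1 = 0.
  have := congr1 (horner^~ 0) E.
  by rewrite horner_comp !hornerE expr0n n0 mulr0.
have E1 : 2 * (n%:R * s ^+ n.-1 + 1) = 0.
  have := congr1 (horner^~ 0) dE.
  rewrite horner_comp deriv_trinomial derivZ derivXn !(hornerE, hornerMn).
  by rewrite expr0n n10 mul0rn mulr0 mulrDr mulrA mulr1 /= -addrA.
have {}E1 : n%:R * s ^+ n.-1 = -1.
  by apply/eqP; rewrite -addr_eq0; move/eqP: E1; rewrite mulf_eq0 (negPf two0).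
(* For [n = 2] the second derivative of [a *: 'X^n] is constant and need not vanish at 0; instead
   2f(s) - (2s + 1)^2 = 1 settles this case. *)
have [n2|n_neq2] := eqVneq n 2.
  move: E0 E1; rewrite n2 /= expr1 => E0 E1.
  have : 1 = 2 * (2 * s ^+ 2 + 2 * s + 1) - (2 * s + 1) ^+ 2 by ring.
  by rewrite E0 E1 addNr mulr0 expr0n subr0 => /eqP; rewrite oner_eq0.
have E2 : (2 * n%:R) * (n.-1%:R * s ^+ n.-2) = 0.
  have := congr1 (horner^~ 0) ddE.
  rewrite horner_comp deriv_trinomial derivD derivM !derivC derivXn.
  rewrite derivZ derivXn derivZ derivMn derivXn.
  have n20 : (n.-2 == 0)%N = false by lia.
  rewrite !(hornerE, hornerMn) expr0n n20 !mul0rn mulr0 => <-.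
  by rewrite -(mulr_natl (s ^+ n.-2)) /= mulrA.
have nat0 : n%:R != 0 :> F.
  by apply: contra_eq_neq E1 => ->; rewrite mul0r eq_sym oppr_eq0 oner_eq0.
have s0 : s ^+ n.-2 != 0.
  rewrite expf_neq0 //; apply: contra_eq_neq E1 => ->.
  by rewrite expr0n n10 mulr0 eq_sym oppr_eq0 oner_eq0.
have nE : n = n.-1.+1 by rewrite prednK // ltnW.
(* In [E2] only the factor n - 1 can vanish in [F]. *)
have n1 : n%:R = 1 :> F.
  move/eqP: E2; rewrite !mulf_eq0 (negPf two0) (negPf nat0) (negPf s0) /= orbF.
  by move/eqP => E2; rewrite nE -natr1 E2 add0r.
(* Now s^(n-1) = -1, so 2s^n cancels 2s in [E0], leaving 1 = 0. *)
move: E0; rewrite nE exprS; move: E1; rewrite n1 mul1r => ->.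
by rewrite mulrN1 mulrN addNr add0r => /eqP; rewrite oner_eq0.
Qed.

Lemma odd_multiple_irreducible (n k : nat) : (1 < n)%N ->
  irreducible_polys n (k.*2.+1%:Z *: trinomial int n).
Proof.
move=> n_gt1; have k0 : k.*2.+1%:Z != 0 by [].
split; first by rewrite size_scale // size_trinomial.
have [n0 n1] : (n == 0)%N = false /\ (n == 1)%N = false by lia.
(* The odd multiplier keeps the constant coefficient odd and the leading one not divisible by 4. *)
apply: (@reverse_eisenstein_irreducible 2) => //.
- rewrite coefZ coef_trinomial (eq_sym 0%N) n0 !mulr0 !add0r mulr1.
  by rewrite dvdzE /= dvdn2 /= odd_double.
- move=> i i_gt0; rewrite coefZ coef_trinomial (gtn_eqF i_gt0) addr0 -mulrDr.
  by rewrite mulrCA dvdz_mulr.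
- rewrite lead_coefZ lead_coefE size_trinomial // coef_trinomial eqxx n0 n1.
  rewrite mulr0 !addr0 mulr1 expr2 dvdz_mul2r //.
  by rewrite dvdzE /= dvdn2 /= odd_double.
Qed.

Lemma multiple_trinomial_not_eisenstein (n : nat) (c : int) : (1 < n)%N ->
  ~ shifted_eisensteins n (c *: trinomial int n).
Proof.
move=> n_gt1 [sz [s [sz' [p [p_pr pg _]]]]].
have chp := pchar_Fp p_pr.
set g := _ \Po _ in sz' pg *; move=> pNgn.
have lg : g`_n = c * 2.
  have -> : g`_n = lead_coef g by rewrite lead_coefE sz'.
  rewrite lead_coef_comp ?size_XaddC // lead_coefDl ?size_polyC ?size_polyX;
    last by case: (s == 0).
  rewrite lead_coefX expr1n mulr1 lead_coefZ lead_coefE size_trinomial //.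
  rewrite coef_trinomial eqxx.
  have [-> ->] : (n == 1)%N = false /\ (n == 0)%N = false by lia.
  by rewrite mulr0 !addr0 mulr1.
(* As [p] does not divide 2c, both [c] and 2 are invertible in ['F_p]. *)
move: (pNgn); rewrite lg (dvdz_pcharf chp) rmorphM /= mulf_eq0 negb_or.
case/andP=> c0 two0.
apply: (@trinomial_neq_shift_power 'F_p n ((c%:~R)^-1 * (g`_n)%:~R) s%:~R) => //.
apply: (scalerI c0); rewrite scalerA mulrA mulfV // mul1r.
transitivity (map_poly (intr : int -> 'F_p) g).
  have shiftE : map_poly (intr : int -> 'F_p) ('X + s%:P) = 'X + (s%:~R)%:P.
    by rewrite rmorphD /= map_polyX map_polyC.
  by rewrite map_comp_poly shiftE map_polyZ map_trinomial comp_polyZ.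
(* Coefficients below [n] vanish mod [p] by the Eisenstein condition, those above [n] by the degree
   of [g]. *)
apply/polyP => i; rewrite coef_map coefZ coefXn /=.
have [->|i_neq_n] := eqVneq i n; first by rewrite mulr1.
rewrite mulr0; have [lt_in|le_ni] := ltnP i n.
  by apply/eqP; rewrite -(dvdz_pcharf chp) pg.
by rewrite nth_default ?rmorph0 // sz' ltn_neqAle eq_sym i_neq_n.
Qed.

Local Open Scope classical_set_scope.

Theorem theorem10 (n : nat) (hn : (2 <= n)%N) :
  infinite_set (irreducible_polys n `\` shifted_eisensteins n).
Proof.
pose F k := k.*2.+1%:Z *: trinomial int n.
have F_inj : injective F.
  (* The constant coefficient of [F k] is 2k + 1, which determines [k]. *)
  move=> k l /(congr1 (fun f : {poly int} => f`_0)).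
  rewrite !coefZ coef_trinomial.
  have -> : (0 == n)%N = false by lia.
  rewrite !mulr0 !add0r !mulr1; lia.
apply: (@sub_infinite_set _ (F @` setT)).
  move=> _ [k _ <-]; split; first exact: odd_multiple_irreducible.
  exact: multiple_trinomial_not_eisenstein.
apply/infiniteP; have : (F @` setT #= [set: nat])%card.
  by apply: inj_card_eq => k l _ _ /F_inj.
by rewrite card_eq_le => /andP[].
Qed.
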